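(* If $L$ is a lattice (respectively, an ortholattice, a Heyting algebra, a Boolean algebra), then $L$ embeds into the lattice $\mathfrak{L}(X,\vartriangleleft)$ of $c_\vartriangleleft$-fixpoints of a compatibility frame (respectively, a symmetric compatibility frame, a compossible compatibility frame, a symmetric compossible compatibility frame) $(X,\vartriangleleft)$, and if $L$ is complete, the embedding is an isomorphism.
   Context: A compatibility frame is a pair $(X,\vartriangleleft)$ with $X$ a nonempty set and $\vartriangleleft$ a reflexive binary relation on $X$. It is symmetric if $\vartriangleleft$ is symmetric. Write $y\vartriangleright x$ for $x\vartriangleleft y$, and for $A\subseteq X$ let $c_\vartriangleleft(A)=\{x\in X\mid \forall x'\vartriangleleft x\ \exists x''\vartriangleright x':\ x''\in A\}$. This is a closure operator on $\wp(X)$. A $c_\vartriangleleft$-fixpoint is an $A\subseteq X$ with $c_\vartriangleleft(A)=A$. $\mathfrak{L}(X,\vartriangleleft)$ is the complete lattice of $c_\vartriangleleft$-fixpoints ordered by $\subseteq$ (meets are intersections; $\bigvee A_i=c_\vartriangleleft(\bigcup A_i)$). For $x,y\in X$: $x$ pre-refines $y$ if for all $z\in X$, $z\vartriangleleft x$ implies $z\vartriangleleft y$; $x$ post-refines $y$ if for all $z\in X$, $x\vartriangleleft z$ implies $y\vartriangleleft z$; $x$ refines $y$ if it both pre-refines and post-refines $y$; $x$ is compossible with $y$ if there is $w\in X$ that refines $x$ and pre-refines $y$. A compatibility frame is compossible if for all $x,y\in X$, $x\vartriangleleft y$ implies that $x$ is compossible with $y$. An ortholattice is a bounded lattice with a unary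 operation $\neg$ that is antitone, involutive, and satisfies $a\wedge\neg a=0$, $a\vee\neg a=1$.
   Formalization: The isomorphism clause, and preservation of bounds, negation and implication, are stated only for L with at least two elements: since X is nonempty and the relation reflexive, ∅ and X are distinct fixpoints, so the claim fails for the one-element L. *)

(* Defs.v *)
From HB Require Import structures.
From mathcomp Require Import all_boot all_order.
From mathcomp Require Import boolp classical_sets.

Set Implicit Arguments.
Unset Strict Implicit.
Unset Printing Implicit Defensive.

Import Order.TTheory.

Record compatFrame := CompatFrame {
  point :> Type;
  compat : point -> point -> Prop;
  compat_refl : forall x, compat x x;
  point_inhabited : inhabited point;
}.

Notation "x <| y" := (compat x y) (at level 70, no associativity).

Section Frames.
Variable F : compatFrame.
Implicit Types (x y z w : F) (A B : set F).

Definition symmetric_frame := forall x y, x <| y -> y <| x.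

Definition pre_refines x y := forall z, z <| x -> z <| y.
Definition post_refines x y := forall z, x <| z -> y <| z.
Definition refines x y := pre_refines x y /\ post_refines x y.
Definition compossible x y := exists w, refines w x /\ pre_refines w y.

Definition compossible_frame := forall x y, x <| y -> compossible x y.

Definition cl A : set F :=
  [set x | forall x', x' <| x -> exists x'', x' <| x'' /\ A x'']%classic.

Lemma sub_cl A : (A `<=` cl A)%classic.
Proof. by move=> x Ax x' xx; exists x. Qed.

Lemma clS A B : (A `<=` B -> cl A `<=` cl B)%classic.
Proof. by move=> AB x cx x' /cx[x'' [? /AB]]; exists x''. Qed.

Lemma clK A : cl (cl A) = cl A.
Proof.
apply/seteqP; split; last exact: sub_cl.
by move=> x cx x' /cx[x'' [xx /(_ _ xx)]].
Qed.

Record fixpoint := Fixpoint_ { fset_of : set F; fixpointP : cl fset_of = fset_of }.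

Lemma fixpoint_eq (A B : fixpoint) : fset_of A = fset_of B -> A = B.
Proof. by case: A B => A hA [B hB] /= e; subst B; congr Fixpoint_. Qed.

HB.instance Definition _ := gen_eqMixin fixpoint.
HB.instance Definition _ := gen_choiceMixin fixpoint.

Definition fle (A B : fixpoint) : bool := `[< fset_of A `<=` fset_of B >]%classic.

Lemma fle_refl : reflexive fle.
Proof. by move=> A; apply/asboolP. Qed.

Lemma fle_anti : antisymmetric fle.
Proof.
move=> A B /andP[/asboolP AB /asboolP BA].
by apply: fixpoint_eq; apply/seteqP.
Qed.

Lemma fle_trans : transitive fle.
Proof.
by move=> B A C /asboolP AB /asboolP BC; apply/asboolP; apply: subset_trans BC.
Qed.

Fact fixpoint_display : Order.disp_t. Proof. exact: Order.Disp tt tt. Qed.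

HB.instance Definition _ :=
  Order.Le_isPOrder.Build fixpoint_display fixpoint fle_refl fle_anti fle_trans.

Lemma fleP (A B : fixpoint) :
  reflect (fset_of A `<=` fset_of B)%classic (A <= B)%O.
Proof. exact: asboolP. Qed.

Lemma cl_fset (A : fixpoint) B : (B `<=` fset_of A -> cl B `<=` fset_of A)%classic.
Proof. by rewrite -{2}(fixpointP A); apply: clS. Qed.

Lemma fmeet_subproof (A B : fixpoint) : (cl (fset_of A `&` fset_of B) = fset_of A `&` fset_of B)%classic.
Proof.
apply/seteqP; split; last exact: sub_cl.
by move=> x cx; split; apply: cl_fset x cx => y [].
Qed.
Definition fmeet (A B : fixpoint) := Fixpoint_ (fmeet_subproof A B).

Definition fcl A := Fixpoint_ (clK A).

Definition fjoin (A B : fixpoint) := fcl (fset_of A `|` fset_of B)%classic.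

Lemma fmeetP (A B C : fixpoint) :
  (A <= fmeet B C)%O = (A <= B)%O && (A <= C)%O.
Proof.
apply/fleP/andP => [AB|[/fleP AB /fleP AC] x Ax]; last by split; auto.
by split; apply/fleP => x /AB[].
Qed.

Lemma fjoinP (A B C : fixpoint) :
  (fjoin A B <= C)%O = (A <= C)%O && (B <= C)%O.
Proof.
apply/fleP/andP => [AB|[/fleP AC /fleP BC]]; last first.
  by apply: cl_fset => x [/AC|/BC].
by split; apply/fleP => x Ax; apply: AB; apply: sub_cl; [left|right].
Qed.

HB.instance Definition _ :=
  Order.POrder_MeetJoin_isLattice.Build fixpoint_display fixpoint fmeetP fjoinP.

Lemma fbot_subproof : cl set0 = set0.
Proof.
apply/seteqP; split=> // x /(_ x (compat_refl x)).
by case=> ? [].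
Qed.
Definition fbot := Fixpoint_ fbot_subproof.

Lemma ftop_subproof : cl setT = setT.
Proof. by apply/seteqP; split=> //; apply: sub_cl. Qed.
Definition ftop := Fixpoint_ ftop_subproof.

Lemma fle0x (A : fixpoint) : (fbot <= A)%O.
Proof. by apply/fleP => x []. Qed.

Lemma flex1 (A : fixpoint) : (A <= ftop)%O.
Proof. by apply/fleP. Qed.

HB.instance Definition _ :=
  Order.hasBottom.Build fixpoint_display fixpoint fle0x.
HB.instance Definition _ := Order.hasTop.Build fixpoint_display fixpoint flex1.

(* The orthocomplement of a symmetric frame, see [fixpoint_ortholattice]. *)
Lemma fneg_subproof (A : fixpoint) :
  cl [set x | forall x', x' <| x -> ~ fset_of A x']%classic =
     [set x | forall x', x' <| x -> ~ fset_of A x']%classic.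
Proof.
apply/seteqP; split; last exact: sub_cl.
by move=> x cx x' /cx[x'' [xx nA]]; apply: nA.
Qed.
Definition fneg (A : fixpoint) := Fixpoint_ (fneg_subproof A).

(* The join of all fixpoints C with A `&` C <= B; it is the relative
   pseudocomplement when F is compossible, see [fixpoint_heyting]. *)
Definition fimp (A B : fixpoint) : fixpoint :=
  fcl (\bigcup_(C in [set C : fixpoint | (A `&` C <= B)%O]) fset_of C)%classic.

End Frames.

Definition complete_lattice d (L : latticeType d) :=
  forall S : set L, (supremums S !=set0)%classic.

(* [compat] is reflexive on an inhabited type, so set0 and setT are always two
   distinct fixpoints: [fixpoint F] is never a one-element lattice. *)
Definition nontrivial (L : Type) := exists x y : L, x <> y.

Record is_ortholattice d (L : tbLatticeType d) (neg : L -> L) : Prop := {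
  neg_antitone : forall a b : L, (a <= b)%O -> (neg b <= neg a)%O;
  neg_involutive : involutive neg;
  meet_neg : forall a : L, (a `&` neg a = \bot)%O;
  join_neg : forall a : L, (a `|` neg a = \top)%O;
}.

Definition is_heyting d (L : tbLatticeType d) (imp : L -> L -> L) :=
  forall a b c : L, (a `&` c <= b)%O = (c <= imp a b)%O.

Definition lattice_embedding d (L : latticeType d) d' (M : latticeType d')
    (f : L -> M) :=
  [/\ injective f, Order.meet_morphism f & Order.join_morphism f].

Definition bounded_embedding d (L : tbLatticeType d) d' (M : tbLatticeType d')
    (f : L -> M) :=
  [/\ lattice_embedding f, f \bot%O = \bot%O & f \top%O = \top%O].

Lemma fixpoint_complete (F : compatFrame) : complete_lattice (fixpoint F).
Proof.
move=> S; exists (fcl (\bigcup_(A in S) fset_of A)%classic); split.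
  by move=> A SA; apply/fleP => x Ax; apply: sub_cl; exists A.
by move=> B ub; apply/fleP/cl_fset => x [A /ub/fleP]; apply.
Qed.

Lemma fixpoint_ortholattice (F : compatFrame) :
  symmetric_frame F -> is_ortholattice (@fneg F).
Proof.
move=> sF; have anti (A B : fixpoint F) : (A <= B)%O -> (fneg B <= fneg A)%O.
  by move=> /fleP AB; apply/fleP => x nB x' /nB + /AB.
have inv : involutive (@fneg F).
  move=> A; apply: fixpoint_eq; apply/seteqP; split=> x.
    move=> nnA; rewrite -(fixpointP A) => x' /nnA /existsNP[x''].
    move=> /not_implyP[xx /contrapT Ax]; exists x''; split=> //.
    exact: sF.
  by move=> Ax x' xx /(_ x (sF _ _ xx)).
have meetN (A : fixpoint F) : (A `&` fneg A = \bot)%O.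
  apply/eqP; rewrite -lex0; apply/fleP => x [Ax].
  by move=> /(_ x (compat_refl x)).
split=> // A; apply/eqP; rewrite -le1x -(inv (A `|` fneg A)%O).
apply/fleP => x _ x' _ nJ.
have /fleP/(_ _ nJ) nA := anti _ _ (leUl A (fneg A)).
have /fleP/(_ _ nJ) nnA := anti _ _ (leUr (fneg A) A).
have : fset_of (fneg A `&` fneg (fneg A))%O x' by [].
by rewrite meetN.
Qed.

Lemma fixpoint_heyting (F : compatFrame) :
  compossible_frame F -> is_heyting (@fimp F).
Proof.
move=> cF A B C; apply/idP/idP => [AC|/fleP CI].
  by apply/fleP => x Cx; apply: sub_cl; exists C.
apply/fleP => x [Ax Cx]; rewrite -(fixpointP B) => x' xx.
have down (D : fixpoint F) u v : pre_refines u v -> fset_of D v -> fset_of D u.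
  by move=> uv; rewrite -(fixpointP D) => Dv z /uv /Dv.
have [w [[wx' wx'2] wx]] := cF _ _ xx.
have [u [wu [D /fleP AD Du]]] := CI _ (down _ _ _ wx Cx) w (compat_refl w).
have [v [[vw vw2] vu]] := cF _ _ wu.
exists v; split; first by apply/wx'2/vw2/compat_refl.
by apply: AD; split; [apply/(down _ _ _ vw)/(down _ _ _ wx)|apply: down vu Du].
Qed.

(* Main.v *)
Require Import Defs.
From mathcomp Require Import all_boot all_order.
From mathcomp Require Import boolp classical_sets.

(** The lattice of fixpoints can be made into the MacNeille completion of [L],
    into which [L] embeds and with which [L] coincides when it is complete.
    Let every point [x] of the frame carry two elements of [L]: an approximation
    [p x] from below (what [x] asserts) and [q x] from above (what [x] rejects),
    with [p x] not below [q x].  Put [x <| y] when [x] does not reject what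
    [y] asserts, i.e. when [p y] is not below [q x].  If the [p x] are join-dense
    and the [q x] are meet-dense in [L], then [a |-> {x | p x <= a}] takes values
    in fixpoints ([cl_below]), is a lattice embedding ([below_embedding]), and
    hits every fixpoint [A] whose set of assertions [p x], [x] in [A], has a
    supremum ([below_bijective]).

    The four cases differ only in which pairs are kept, the freedom being used to
    obtain the required property of the frame.
    - Lattices: all pairs [(a, b)] with [a] not below [b].
    - Ortholattices: the pairs [(a, neg a)] with [a] nonzero.  Then [x <| y] says
      that [y] is not below [neg x], which is symmetric.
    - Heyting algebras: the pairs [(a, imp a b)] with [a] not below [b].  By
      residuation [(a, b) <| (c, d)] says that the meet of [a] and [c] is not
      below [b], so that this meet, together with the same [b], is again a point;
      it witnesses compossibility.
    - Boolean algebras: the frame of the underlying ortholattice.  There [x <| y]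
      says that the meet of [x] and [y] is nonzero, and this meet witnesses
      compossibility.

    The embedding preserves negation and implication because those of the
    fixpoints are determined by the order of points: [fneg] of the image of [a]
    consists of the points incompatible with everything below [a], and [fimp] is
    the relative pseudocomplement since the frame is compossible.

    These frames have no point when [L] has at most one element; such an [L] is
    sent to any element of any lattice of fixpoints. *)

Set Implicit Arguments.
Unset Strict Implicit.
Unset Printing Implicit Defensive.

Import Order.Theory.
Local Open Scope order_scope.

(** * Lattices with at most one element *)

Definition unit_frame : compatFrame :=
  @CompatFrame unit (fun _ _ => True) (fun _ => I) (inhabits tt).

Lemma unit_frame_symmetric : symmetric_frame unit_frame.
Proof. by []. Qed.

Lemma unit_frame_compossible : compossible_frame unit_frame.
Proof. by move=> x y _; exists x. Qed.

Lemma trivial_embedding d (L : latticeType d) (F : compatFrame) :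
  ~ nontrivial L -> lattice_embedding (fun _ : L => \bot : fixpoint F).
Proof.
move=> triv; split=> [x y _|x y|x y]; last 2 first.
- by rewrite meetxx.
- by rewrite joinxx.
by apply: contrapT => xy; apply: triv; exists x, y.
Qed.

(** * Frames of assertions and rejections *)

Section PairFrame.
Context {d : Order.disp_t} {L : latticeType d} {X : Type} (p q : X -> L).
Hypothesis p_nle_q : forall x, ~~ (p x <= q x).
Hypothesis X_inhabited : inhabited X.

Definition pair_frame : compatFrame :=
  @CompatFrame X (fun x y => ~~ (p y <= q x)) p_nle_q X_inhabited.

Lemma pre_refines_pair (x y : pair_frame) : p x <= p y -> pre_refines x y.
Proof. by move=> xy z; apply: contraNN; apply: le_trans xy. Qed.

Lemma post_refines_pair (x y : pair_frame) : q y <= q x -> post_refines x y.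
Proof. by move=> yx z; apply: contraNN => zy; apply: le_trans yx. Qed.

Hypothesis p_dense : forall a b, ~~ (a <= b) -> exists x, p x <= a /\ ~~ (p x <= b).
Hypothesis q_dense : forall a b, ~~ (a <= b) -> exists x, ~~ (a <= q x) /\ b <= q x.

(** Meet-density is what closes these sets: if [p x] is not below [a], some point
    rejects [a], hence everything in the set, without rejecting [p x]. *)
Lemma cl_below a :
  cl [set x : pair_frame | p x <= a]%classic = [set x | p x <= a]%classic.
Proof.
apply/seteqP; split; last exact: sub_cl.
move=> x cx; apply: contrapT => /negP /q_dense[x' [xx' ax']].
have [x'' [/negP + x''a]] := cx x' xx'.
by apply; apply: le_trans ax'.
Qed.
Definition below a : fixpoint pair_frame := Fixpoint_ (cl_below a).

(** Join-density makes the assertions below [a] as good as [a] itself. *)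
Lemma le_below a b : (below a <= below b) = (a <= b).
Proof.
apply/fleP/idP => [ab|ab x /= xa]; last exact: le_trans ab.
by apply: contrapT => /negP /p_dense[x [/ab /= ->]].
Qed.

Lemma below_embedding : lattice_embedding below.
Proof.
split=> [a b ab|a b|a b].
- by apply: le_anti; rewrite -!le_below ab lexx.
- apply: fixpoint_eq; apply/seteqP; split=> x /=; first by rewrite lexI => /andP.
  by move=> [/= xa xb]; rewrite lexI xa xb.
apply: le_anti; rewrite leUx !le_below leUl leUr !andbT.
apply/fleP => x /= xab x' xx'.
(* A point that does not reject the join does not reject one of its terms. *)
have : ~~ (a `|` b <= q x') by apply: contraNN xx'; apply: le_trans.
rewrite leUx negb_and => /orP[] /p_dense[y [ya yx']]; exists y; split=> //.
  by left.
by right.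
Qed.

(** A fixpoint consists of all assertions below the supremum [s] of its own: a
    point that does not reject [s] fails to reject one of these. *)
Lemma below_bijective : complete_lattice L -> bijective below.
Proof.
move=> cL; have [inj _ _] := below_embedding.
suff /choice[g gK] : forall A, exists a, below a = A.
  by exists g => // a; apply: inj; rewrite gK.
move=> A; have [s [ubs lubs]] := cL [set p x | x in fset_of A]%classic.
exists s; apply: fixpoint_eq; apply/seteqP; split=> x /=; last first.
  by move=> Ax; apply: ubs; exists x.
rewrite -(fixpointP A) => xs x' xx'; apply: contrapT => noA.
have /negP[] := xx'; apply: le_trans xs _; apply: lubs => _ [y Ay <-].
by apply: contrapT => /negP yx'; apply: noA; exists y.
Qed.

End PairFrame.

Lemma below_bounded d (L : tbLatticeType d) X (p q : X -> L)
    (p_nle_q : forall x, ~~ (p x <= q x)) (X_inhabited : inhabited X)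
    (q_dense : forall a b, ~~ (a <= b) -> exists x, ~~ (a <= q x) /\ b <= q x) :
  (forall a b, ~~ (a <= b) -> exists x, p x <= a /\ ~~ (p x <= b)) ->
  bounded_embedding (below p_nle_q X_inhabited q_dense).
Proof.
move=> p_dense; split; first exact: below_embedding.
- apply: fixpoint_eq; apply/seteqP; split=> // x /= x0.
  by have /negP[] := p_nle_q x; apply: le_trans x0 (le0x _).
- by apply: fixpoint_eq; apply/seteqP; split=> // x _ /=; apply: lex1.
Qed.

Lemma nontrivial_nle d (L : latticeType d) :
  nontrivial L -> exists a b : L, ~~ (a <= b).
Proof.
move=> [x [y xy]]; have [lxy|] := boolP (x <= y); last by exists x, y.
have [lyx|] := boolP (y <= x); last by exists y, x.
by case: xy; apply: le_anti; rewrite lxy.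
Qed.

Definition nle_pair d (L : latticeType d) := {ab : L * L | ~~ (ab.1 <= ab.2)}.

Lemma nle_pair_inhabited d (L : latticeType d) :
  nontrivial L -> inhabited (nle_pair L).
Proof. by move=> /nontrivial_nle[a [b ab]]; split; exists (a, b). Qed.

(** * Lattices *)

Lemma lattice_representation d (L : latticeType d) :
  nontrivial L ->
  exists (F : compatFrame) (f : L -> fixpoint F),
    lattice_embedding f /\ (complete_lattice L -> bijective f).
Proof.
move=> /nle_pair_inhabited X0.
pose p (x : nle_pair L) := (sval x).1; pose q (x : nle_pair L) := (sval x).2.
have pq x : ~~ (p x <= q x) := svalP x.
have p_dense a b : ~~ (a <= b) -> exists x, p x <= a /\ ~~ (p x <= b).
  by move=> ab; exists (exist _ (a, b) ab); rewrite /p /= lexx.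
have q_dense a b : ~~ (a <= b) -> exists x, ~~ (a <= q x) /\ b <= q x.
  by move=> ab; exists (exist _ (a, b) ab); rewrite /q /= lexx.
exists (pair_frame pq X0), (below pq X0 q_dense).
by split; [exact: below_embedding | exact: below_bijective].
Qed.

(** * Ortholattices and Boolean algebras *)

Section Ortholattice.
Context {d : Order.disp_t} {L : tbLatticeType d} {neg : L -> L}.
Hypothesis orthoP : is_ortholattice neg.
Hypothesis L_nontrivial : nontrivial L.

Definition nonzero := {a : L | a != \bot}.

Lemma le_neg_sym a b : a <= neg b -> b <= neg a.
Proof. by move=> /(neg_antitone orthoP); rewrite (neg_involutive orthoP). Qed.

Lemma nle_neg (x : nonzero) : ~~ (sval x <= neg (sval x)).
Proof.
case: x => x x0 /=; apply: contraNN x0 => /meet_idPl xn.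
by rewrite -xn (meet_neg orthoP).
Qed.

Lemma nle_neq0 (a b : L) : ~~ (a <= b) -> a != \bot.
Proof. by apply: contraNneq => ->; apply: le0x. Qed.

Lemma nonzero_inhabited : inhabited nonzero.
Proof.
by have [a [b /nle_neq0 a0]] := nontrivial_nle L_nontrivial; split; exists a.
Qed.

Lemma nonzero_dense a b :
  ~~ (a <= b) -> exists x : nonzero, sval x <= a /\ ~~ (sval x <= b).
Proof. by move=> ab; exists (exist _ a (nle_neq0 ab)); rewrite /= lexx. Qed.

Lemma neg_nonzero_dense a b :
  ~~ (a <= b) -> exists x : nonzero, ~~ (a <= neg (sval x)) /\ b <= neg (sval x).
Proof.
move=> ab; have nb0 : neg b != \bot.
  apply: (@nle_neq0 _ (neg a)); apply: contraNN ab => /(neg_antitone orthoP).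
  by rewrite !(neg_involutive orthoP).
by exists (exist _ (neg b) nb0); rewrite /= (neg_involutive orthoP) lexx.
Qed.

Definition ortho_frame : compatFrame := pair_frame nle_neg nonzero_inhabited.

Definition ortho_below : L -> fixpoint ortho_frame :=
  below nle_neg nonzero_inhabited neg_nonzero_dense.

Lemma ortho_frame_symmetric : symmetric_frame ortho_frame.
Proof. by move=> x y; apply: contraNN; apply: le_neg_sym. Qed.

Lemma ortho_below_neg a : ortho_below (neg a) = fneg (ortho_below a).
Proof.
apply: fixpoint_eq; apply/seteqP; split=> x /= xa.
  move=> x' /negP xx' x'a; apply: xx'; apply: le_trans xa _.
  exact: neg_antitone orthoP _ _ x'a.
apply: contrapT => /negP xna.
have a0 : a != \bot.
  by apply: (@nle_neq0 _ (neg (sval x))); apply: contraNN xna; apply: le_neg_sym.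
(* [a] itself is a point that [x] would have to be incompatible with. *)
exact: (xa (exist _ a a0) xna (lexx a)).
Qed.

Lemma ortho_representation :
  bounded_embedding ortho_below /\
  (forall a, ortho_below (neg a) = fneg (ortho_below a)) /\
  (complete_lattice L -> bijective ortho_below).
Proof.
split; first exact: below_bounded nonzero_dense.
split; first exact: ortho_below_neg.
exact: (below_bijective _ _ nonzero_dense).
Qed.

End Ortholattice.

Lemma compl_ortholattice d (L : ctbDistrLatticeType d) :
  is_ortholattice (fun a : L => ~` a).
Proof.
split=> [a b|||]; first by rewrite leC.
- exact: complK.
- exact: meetxC.
- exact: joinxC.
Qed.

(** Here distributivity enters: disjoint elements satisfy [x <= ~` y], i.e. they are
    incompatible, so compatible ones have a nonzero meet. *)
Lemma boolean_frame_compossible d (L : ctbDistrLatticeType d) (nL : nontrivial L) :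
  compossible_frame (ortho_frame (compl_ortholattice L) nL).
Proof.
move=> x y xy; have xy0 : sval x `&` sval y != \bot.
  by apply: contraNN xy; rewrite meetC disj_leC.
pose w : nonzero := exist _ (sval x `&` sval y) xy0.
exists w; split; last by apply: pre_refines_pair; apply: leIr.
split; first by apply: pre_refines_pair; apply: leIl.
by apply: post_refines_pair; rewrite leC leIl.
Qed.

(** * Heyting algebras *)

Section Heyting.
Context {d : Order.disp_t} {L : tbLatticeType d} {imp : L -> L -> L}.
Hypothesis impP : is_heyting imp.
Hypothesis L_nontrivial : nontrivial L.

Let asserted (x : nle_pair L) : L := (sval x).1.
Let rejected (x : nle_pair L) : L := imp (sval x).1 (sval x).2.

Lemma nle_imp x : ~~ (asserted x <= rejected x).
Proof. by rewrite -impP meetxx (svalP x). Qed.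

Lemma asserted_dense a b :
  ~~ (a <= b) -> exists x, asserted x <= a /\ ~~ (asserted x <= b).
Proof. by move=> ab; exists (exist _ (a, b) ab); rewrite /asserted /= lexx. Qed.

(** The element [b] is rejected by the point [(\top, b)], as [imp \top b = b]. *)
Lemma rejected_dense a b :
  ~~ (a <= b) -> exists x, ~~ (a <= rejected x) /\ b <= rejected x.
Proof.
move=> ab; have tb : ~~ (\top <= b) by apply: contraNN ab; apply/le_trans/lex1.
by exists (exist _ (\top, b) tb); rewrite /rejected /= -!impP !meet1x lexx.
Qed.

Definition heyting_frame : compatFrame :=
  pair_frame nle_imp (nle_pair_inhabited L_nontrivial).

Definition heyting_below : L -> fixpoint heyting_frame :=
  below nle_imp (nle_pair_inhabited L_nontrivial) rejected_dense.

Lemma heyting_frame_compossible : compossible_frame heyting_frame.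
Proof.
move=> x y xy; have xyb : ~~ (asserted x `&` asserted y <= (sval x).2).
  by rewrite impP.
pose w : nle_pair L := exist _ (_, _) xyb.
exists w; split; last by apply: pre_refines_pair; apply: leIr.
split; first by apply: pre_refines_pair; apply: leIl.
apply: post_refines_pair; rewrite /rejected /= -impP.
(* The meet is below [asserted x], and [imp] is antitone in its first argument. *)
by apply: le_trans (leI2 (leIl _ _) (lexx _)) _; rewrite impP.
Qed.

(** One inclusion is residuation among fixpoints.  For the other, a point [x] of a
    fixpoint [C] that is not below [imp a b] meets [a] in something not below [b],
    so that [C] cannot meet the image of [a] inside that of [b]. *)
Lemma heyting_below_imp a b :
  heyting_below (imp a b) = fimp (heyting_below a) (heyting_below b).
Proof.
have [_ meetE _] := below_embedding nle_imp (nle_pair_inhabited L_nontrivial)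
  asserted_dense rejected_dense.
apply: le_anti; apply/andP; split.
  rewrite -(fixpoint_heyting heyting_frame_compossible) -meetE le_below.
    by rewrite impP.
  exact: asserted_dense.
apply/fleP/cl_fset => x [C /fleP aCb Cx] /=.
rewrite -impP; apply: contrapT => /negP xab.
(* Points of [C] can be strengthened: [x] meets [a] inside [C]. *)
pose y : heyting_frame := exist _ (a `&` asserted x, b) xab.
have Cy : fset_of C y.
  move: Cx; rewrite -(fixpointP C) => Cx z zy; apply: Cx.
  exact: (@pre_refines_pair _ _ _ _ _ _ _ y x (leIr _ _)) zy.
have /negP[] := xab; apply: (aCb y); split=> //; exact: leIl.
Qed.

Lemma heyting_representation :
  bounded_embedding heyting_below /\
  (forall a b, heyting_below (imp a b) = fimp (heyting_below a) (heyting_below b)) /\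
  (complete_lattice L -> bijective heyting_below).
Proof.
split; first exact: below_bounded asserted_dense.
split; first exact: heyting_below_imp.
exact: (below_bijective _ _ asserted_dense).
Qed.

End Heyting.

(** * The representation theorem *)

Theorem theorem3p18 :
  (forall (d : Order.disp_t) (L : latticeType d),
     exists (F : compatFrame) (f : L -> fixpoint F),
       lattice_embedding f /\
       (nontrivial L -> complete_lattice L -> bijective f)) /\
  (forall (d : Order.disp_t) (L : tbLatticeType d) (neg : L -> L),
     is_ortholattice neg ->
     exists (F : compatFrame) (f : L -> fixpoint F),
       symmetric_frame F /\
       lattice_embedding f /\
       (nontrivial L ->
          bounded_embedding f /\
          (forall a : L, f (neg a) = fneg (f a)) /\
          (complete_lattice L -> bijective f))) /\
  (forall (d : Order.disp_t) (L : tbLatticeType d) (imp : L -> L -> L),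
     is_heyting imp ->
     exists (F : compatFrame) (f : L -> fixpoint F),
       compossible_frame F /\
       lattice_embedding f /\
       (nontrivial L ->
          bounded_embedding f /\
          (forall a b : L, f (imp a b) = fimp (f a) (f b)) /\
          (complete_lattice L -> bijective f))) /\
  (forall (d : Order.disp_t) (L : ctbDistrLatticeType d),
     exists (F : compatFrame) (f : L -> fixpoint F),
       symmetric_frame F /\
       compossible_frame F /\
       lattice_embedding f /\
       (nontrivial L ->
          bounded_embedding f /\
          (forall a : L, f (~` a)%O = fneg (f a)) /\
          (complete_lattice L -> bijective f))).
Proof.
split; [|split; [|split]].
- move=> d L; have [nL|triv] := pselect (nontrivial L).
    by have [F [f [emb bij]]] := lattice_representation nL; exists F, f.
  by exists unit_frame, (fun=> \bot); split=> //; apply: trivial_embedding.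
- move=> d L neg oL; have [nL|triv] := pselect (nontrivial L).
    have rep := ortho_representation oL nL; have [[emb _ _] _] := rep.
    exists (ortho_frame oL nL), (ortho_below oL nL).
    by split; first exact: ortho_frame_symmetric.
  exists unit_frame, (fun=> \bot); split; first exact: unit_frame_symmetric.
  by split=> //; apply: trivial_embedding.
- move=> d L imp hL; have [nL|triv] := pselect (nontrivial L).
    have rep := heyting_representation hL nL; have [[emb _ _] _] := rep.
    exists (heyting_frame hL nL), (heyting_below hL nL).
    by split; first exact: heyting_frame_compossible.
  exists unit_frame, (fun=> \bot); split; first exact: unit_frame_compossible.
  by split=> //; apply: trivial_embedding.
move=> d L; have [nL|triv] := pselect (nontrivial L).
  have oL := compl_ortholattice L.
  have rep := ortho_representation oL nL; have [[emb _ _] _] := rep.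
  exists (ortho_frame oL nL), (ortho_below oL nL).
  split; first exact: ortho_frame_symmetric.
  by split; first exact: boolean_frame_compossible.
exists unit_frame, (fun=> \bot); split; first exact: unit_frame_symmetric.
split; first exact: unit_frame_compossible.
by split=> //; apply: trivial_embedding.
Qed.
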